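(* If $G$ is a finite $5$-centralizer group, then $G$ is commuting integral.
   Context: For an element $x$ of a group $G$, $C_G(x)=\{y\in G: xy=yx\}$ is its centralizer. Let $\operatorname{Cent}(G)=\{C_G(x): x\in G\}$ be the set of distinct element centralizers (including $G$ itself, the centralizer of central elements). $G$ is called an $n$-centralizer group if $|\operatorname{Cent}(G)|=n$. For a non-abelian group $G$ with center $Z(G)$, the commuting graph $\Gamma_G$ is the simple undirected graph with vertex set $G\setminus Z(G)$ in which two distinct vertices $x,y$ are adjacent if and only if $xy=yx$. A finite graph is integral if all eigenvalues of its adjacency matrix are integers. A finite non-abelian group $G$ is called commuting integral if $\Gamma_G$ is integral. *)

(* Defs.v *)
From HB Require Import structures.
From mathcomp Require Import all_boot all_order all_algebra all_fingroup all_solvable all_field.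

Set Implicit Arguments.
Unset Strict Implicit.
Unset Printing Implicit Defensive.

Import Order.TTheory GRing.Theory Num.Theory.

Local Open Scope group_scope.

Definition Cent (gT : finGroupType) (G : {group gT}) : {set {set gT}} :=
  [set 'C_G[x] | x in G].

Definition n_centralizer (n : nat) (gT : finGroupType) (G : {group gT}) : Prop :=
  #|Cent G| = n.

Record simple_graph := SimpleGraph {
  vertex : finType;
  adj : rel vertex;
  adj_sym : symmetric adj;
  adj_irr : irreflexive adj
}.

Definition adjacency_matrix (X : simple_graph) : 'M[algC]_#|vertex X| :=
  (\matrix_(i, j) (adj (enum_val i) (enum_val j))%:R)%R.

(* Eigenvalues are taken in the algebraically closed field algC; the
   characteristic polynomial is integral, so no complex eigenvalue is missed. *)
Definition integral_graph (X : simple_graph) : Prop :=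
  forall a : algC, eigenvalue (adjacency_matrix X) a -> a \is a Num.int.

Section CommutingGraph.
Variables (gT : finGroupType) (G : {group gT}).

Definition noncentral := {x : gT | x \in G :\: 'Z(G)}.

Definition commuting_adj : rel noncentral :=
  fun x y => (x != y) && (val x * val y == val y * val x).

Lemma commuting_adj_sym : symmetric commuting_adj.
Proof. by move=> x y; rewrite /commuting_adj eq_sym [_ * _ == _]eq_sym. Qed.

Lemma commuting_adj_irr : irreflexive commuting_adj.
Proof. by move=> x; rewrite /commuting_adj eqxx. Qed.

Definition commuting_graph : simple_graph :=
  SimpleGraph commuting_adj_sym commuting_adj_irr.

Definition commuting_integral : Prop :=
  ~~ abelian G /\ integral_graph commuting_graph.

End CommutingGraph.

(* Main.v *)
Require Import Defs.
From mathcomp Require Import all_boot all_order all_algebra all_fingroup all_solvable all_field.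

(** In a 5-centralizer group, commuting is a transitive relation on the
    noncentral elements ([commuting_trans]): a failure of transitivity around
    an element [x] already produces five centralizers, all of them containing
    [x]; as there are no others, [x] commutes with everything.  This avoids
    determining the possible central quotients of the group.  Transitivity makes
    the commuting graph a disjoint union of cliques, and such a graph has no
    eigenvalues other than [-1] and [m - 1], with [m] the size of a clique
    ([cliques_integral]). *)

Import GRing.Theory.

(** Adding the identity to the adjacency matrix turns it into the matrix of the
    equivalence relation of being equal or adjacent, which maps a vector to its
    sums over the classes.  An eigenvector of that matrix with nonzero eigenvalue
    is therefore constant on each class, and the eigenvalue is the size of any
    class where the eigenvector does not vanish. *)
Lemma cliques_integral (X : simple_graph) :
    (forall x y z : vertex X, adj x y -> adj y z -> x != z -> adj x z) ->
  integral_graph X.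
Proof.
move=> adj_tr a /eigenvalueP [v vA v_neq0].
pose e (i j : 'I_#|vertex X|) := (i == j) || adj (enum_val i) (enum_val j).
have e_sym i j : e i j = e j i by rewrite /e eq_sym adj_sym.
have e_tr i j k : e i j -> e j k -> e i k.
  rewrite /e; case: eqP => [-> //|_] /= ij; case: eqP => [<- _|_ /= jk].
    by rewrite ij orbT.
  case: (eqVneq i k) => //= ik; apply: adj_tr ij jk _.
  by rewrite (inj_eq enum_val_inj).
have class_sum j : (\sum_(i | e i j) v 0 i = (a + 1) * v 0 j)%R.
  have /matrixP /(_ 0%R j) := vA; rewrite !mxE => vAj.
  rewrite (bigD1 j) /=; last by rewrite /e eqxx.
  rewrite mulrDl mul1r -vAj addrC; congr (_ + _)%R.
  rewrite big_mkcond /=; apply: eq_bigr => i _; rewrite mxE /e.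
  case: (eqVneq i j) => [->|_] /=; first by rewrite adj_irr mulr0.
  by rewrite andbT; case: adj; rewrite ?mulr1 ?mulr0.
have [j vj] : exists j, v 0%R j != 0%R by apply/rV0Pn.
have [a1|a1] := eqVneq (a + 1)%R 0%R.
  by rewrite -[a](addrK 1%R) a1 rpredB ?rpred0 ?rpred1.
have v_const i : e i j -> v 0%R i = v 0%R j.
  move=> ij; apply: (mulfI a1); rewrite -!class_sum; apply: eq_bigl => k.
  by apply/idP/idP => [/e_tr|/e_tr]; apply=> //; rewrite e_sym.
have : ((a + 1) * v 0 j = #|[pred i | e i j]|%:R * v 0 j)%R.
  by rewrite -class_sum (eq_bigr _ v_const) sumr_const mulr_natl.
move/(mulIf vj) => a1E.
by rewrite -[a](addrK 1%R) a1E rpredB ?rpred_nat ?rpred1.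
Qed.

Local Open Scope group_scope.

(** If [y] and [z] both commute with [x] but not with each other, then the
    centralizers of [x], [y], [z] and [y * z] are distinct and proper: [y] and
    [z] both lie in the first, just one of them in the second and the third, and
    neither in the fourth.  Together with [G] itself, these five exhaust [Cent G].
    Each contains [x], hence so does the centralizer of every element of [G],
    which contradicts that [x] is not central. *)
Lemma commuting_trans (gT : finGroupType) (G : {group gT}) (x y z : gT) :
    #|Cent G| <= 5 -> x \in G :\: 'Z(G) -> y \in G -> z \in G ->
  commute y x -> commute x z -> commute y z.
Proof.
move=> Cent_le5 /setDP[Gx Zx] Gy Gz cyx cxz.
case: (eqVneq (y * z) (z * y)) => // ncyz.
have memC g h : (h \in 'C_G[g]) = (h \in G) && (g * h == h * g).
  by rewrite inE; congr (_ && _); apply/cent1P/eqP => [->|].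
have Gyz : y * z \in G by rewrite groupM.
have cxyz : commute x (y * z) by apply: commuteM.
have nyz_y : y * (y * z) != y * z * y.
  by rewrite -mulgA (inj_eq (mulgI y)).
have nyz_z : z * (y * z) != y * z * z.
  by rewrite mulgA (inj_eq (mulIg z)) eq_sym.
pose s : seq {set gT} := [:: 'C_G[1]; 'C_G[x]; 'C_G[y]; 'C_G[z]; 'C_G[y * z]].
have sep g h k : k \in 'C_G[g] -> k \notin 'C_G[h] -> 'C_G[g] != 'C_G[h].
  by move=> kg kh; apply: contraNneq kh => <-.
have us : uniq s.
  have nC1x : 'C_G[1] != 'C_G[x].
    apply: contra Zx => /eqP C1x; apply/centerP; split=> // w Gw.
    have : w \in 'C_G[1] by rewrite memC Gw mul1g mulg1 eqxx.
    by rewrite C1x memC => /andP[_ /eqP].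
  have [yC1 zC1] : y \in 'C_G[1] /\ z \in 'C_G[1].
    by rewrite !memC Gy Gz !mul1g !mulg1 !eqxx.
  have [yCx zCx] : y \in 'C_G[x] /\ z \in 'C_G[x].
    by rewrite !memC Gy Gz -cyx cxz !eqxx.
  have [yCy zCz] : y \in 'C_G[y] /\ z \in 'C_G[z].
    by rewrite !memC Gy Gz !eqxx.
  have zCy : z \notin 'C_G[y] by rewrite memC Gz.
  have yCz : y \notin 'C_G[z] by rewrite memC Gy eq_sym.
  have yCyz : y \notin 'C_G[y * z] by rewrite memC Gy eq_sym.
  have zCyz : z \notin 'C_G[y * z] by rewrite memC Gz eq_sym.
  rewrite /= !inE !negb_or nC1x /=.
  rewrite (sep 1 y z) ?(sep 1 z y) ?(sep 1 (y * z) y) //.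
  rewrite (sep x y z) ?(sep x z y) ?(sep x (y * z) y) //.
  by rewrite (sep y z y) ?(sep y (y * z) y) ?(sep z (y * z) z).
have sub : {subset s <= Cent G}.
  move=> C; rewrite !inE => /or4P[||| /orP[|]] /eqP->; exact: imset_f.
have memx C : C \in s -> x \in C.
  rewrite !inE => /or4P[||| /orP[|]] /eqP->; rewrite memC Gx /=.
  - by rewrite mul1g mulg1.
  - by [].
  - exact/eqP.
  - exact/eqP.
  - by rewrite -cxyz.
case/negP: Zx; apply/centerP; split=> // w Gw.
suff /memx : 'C_G[w] \in s by rewrite memC => /andP[_ /eqP].
apply: contraLR Cent_le5 => sCw; rewrite -ltnNge cardE.
apply: (@uniq_leq_size _ ('C_G[w] :: s)); first by rewrite /= sCw.
move=> C; rewrite inE mem_enum => /predU1P[->|/sub //]; exact: imset_f.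
Qed.

Theorem corollary2p6 (gT : finGroupType) (G : {group gT}) :
  n_centralizer 5 G -> commuting_integral G.
Proof.
move=> Cent5; split.
  apply/negP => abG; suff : #|Cent G| <= 1 by rewrite Cent5.
  rewrite -(cards1 (G : {set gT})); apply/subset_leq_card/subsetP => C.
  case/imsetP => x Gx ->; rewrite inE; apply/eqP/setIidPl.
  by rewrite sub_cent1 (subsetP abG).
apply: cliques_integral => x y z /andP[_ /eqP cxy] /andP[_ /eqP cyz] xz.
rewrite /= /commuting_adj xz /=; apply/eqP.
have [/setDP[Gx _] /setDP[Gz _]] := (valP x, valP z).
by apply: (commuting_trans _ G (val y)) => //; [rewrite Cent5 | exact: valP].
Qed.
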